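(* Let $\mathcal{F}=\{\langle\cdot,\cdot\rangle_i\}_{i\in I}$ be a family of inner products on a vector space $V$ of arbitrary dimension over a field $\mathbb{K}$, and assume that $\mathrm{rad}(\mathcal{F})=0$. Then the following assertions are equivalent: (1) $\mathcal{F}$ is simultaneously orthogonalizable. (2) There is an $i\in I$ such that $\mathrm{rad}(\langle\cdot,\cdot\rangle_i)\neq V$ and $\mathrm{rad}(\langle\cdot,\cdot\rangle_i)$ is $\mathcal{F}$-supplemented, for some $\mathcal{F}$-supplement $S'$ such that: (i) the family of inner products $\mathcal{F}|_{S'}$ is simultaneously orthogonalizable and nondegenerate; (ii) the family of inner products $\mathcal{F}|_{\mathrm{rad}(\langle\cdot,\cdot\rangle_i)}$ is simultaneously orthogonalizable.
   Context: An inner product on a $\mathbb{K}$-vector space $V$ means a symmetric bilinear form $V\times V\to\mathbb{K}$ (possibly degenerate). The index set $I$ is nonempty. The radical of an inner product is $\mathrm{rad}(\langle\cdot,\cdot\rangle)=\{x\in V:\langle x,y\rangle=0\ \forall y\in V\}$; the inner product is nondegenerate if its radical is $0$. The radical of the family is $\mathrm{rad}(\mathcal{F})=\bigcap_{i\in I}\mathrm{rad}(\langle\cdot,\cdot\rangle_i)$. A family is nondegenerate if at least one of its members is nondegenerate. A family is simultaneously orthogonalizable if there is a single basis $\{v_j\}$ of the underlying space such that $\langle v_j,v_k\rangle_i=0$ whenever $j\neq k$, for every $i\in I$ (isotropic basis vectors are allowed). For a subspace $S\subseteq V$, $\mathcal{F}|_S$ denotes the family of restrictions of the $\langle\cdot,\cdot\rangle_i$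 to $S\times S$, $i\in I$. A subspace $S\subseteq V$ is $\mathcal{F}$-supplemented if there is a subspace $S'\subseteq V$ (called an $\mathcal{F}$-supplement of $S$) such that $V=S\oplus S'$ and $\langle s,s'\rangle_i=0$ for all $s\in S$, $s'\in S'$, $i\in I$.
   Formalization: The formal theorem additionally assumes V ≠ 0: for V = 0 the radical of the family is 0 and (1) holds with the empty basis, but (2) fails because every rad(⟨·,·⟩_i) equals V. *)

(* Defs.v *)
From HB Require Import structures.
From mathcomp Require Import all_boot all_order all_algebra.
From mathcomp Require Import boolp classical_sets.

Set Implicit Arguments.
Unset Strict Implicit.
Unset Printing Implicit Defensive.

Import GRing.Theory.

Local Open Scope classical_set_scope.
Local Open Scope ring_scope.

(* Linear subspaces of V are the library's [submodClosed V]; inner products,  *)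
(* possibly degenerate, are its symmetric bilinear forms [{symmetric V}].     *)

Section Subspace.
Variables (K : fieldType) (V : lmodType K) (S : submodClosed V).

Definition subspace : Type := {x : V | x \in S}.

HB.instance Definition _ := SubChoice.on subspace.
HB.instance Definition _ := [SubChoice_isSubLmodule of subspace by <:].

End Subspace.

Section Restriction.
Variables (K : fieldType) (V : lmodType K) (S : submodClosed V).
Variable f : {symmetric V}.

Definition restr (x y : subspace S) : K := f (val x) (val y).

Let restr_bilinear : bilinear_for
  (GRing.Scale.Law.clone _ _ *%R _) (GRing.Scale.Law.clone _ _ (idfun \; *%R) _)
  restr.
Proof.
split=> [y | x] a u v; rewrite /restr linearP; last by [].
by rewrite linearPl.
Qed.

HB.instance Definition _ :=
  bilinear_isBilinear.Build K (subspace S) (subspace S) K _ _ restr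
    restr_bilinear.

Let restr_symmetric x y : restr x y = (-1) ^+ false * idfun (restr y x).
Proof. exact: hermitian_subproof. Qed.

HB.instance Definition _ :=
  isHermitianSesquilinear.Build K (subspace S) false idfun restr
    restr_symmetric.

End Restriction.

Arguments restr {K V} S f x y.

Definition restr_family (K : fieldType) (V : lmodType K) (I : Type)
    (F : I -> {symmetric V}) (S : submodClosed V) :
    I -> {symmetric (subspace S)} :=
  fun i => restr S (F i) : {symmetric (subspace S)}.

Section Radical.
Variables (K : fieldType) (V : lmodType K).

Definition radical (f : {symmetric V}) : {pred V} :=
  mem [set x | forall y, f x y = 0].

Lemma radicalP (f : {symmetric V}) x :
  x \in radical f <-> forall y, f x y = 0.
Proof. by split=> [/asboolP | fx]; last apply/asboolP. Qed.

Lemma radical_submod_closed (f : {symmetric V}) : submod_closed (radical f).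
Proof.
split=> [|a x y /radicalP fx /radicalP fy]; apply/radicalP => z.
  by rewrite linear0l.
by rewrite linearPl /= fx fy mulr0 addr0.
Qed.

HB.instance Definition _ (f : {symmetric V}) :=
  GRing.isSubmodClosed.Build K V (radical f) (radical_submod_closed f).

Definition nondegenerate_form (f : {symmetric V}) : Prop :=
  radical f =i pred1 0.

Definition family_radical (I : Type) (F : I -> {symmetric V}) : {pred V} :=
  mem (\bigcap_i [set x | x \in radical (F i)]).

Definition nondegenerate_family (I : Type) (F : I -> {symmetric V}) : Prop :=
  exists i, nondegenerate_form (F i).

End Radical.

(* Hamel basis; linear combinations are indexed by finite sequences of        *)
(* indices, which have to be duplicate-free for linear independence.          *)
Definition is_basis (K : fieldType) (V : lmodType K) (J : eqType)
    (v : J -> V) : Prop :=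
  (forall (s : seq J) (c : J -> K), uniq s ->
     \sum_(j <- s) c j *: v j = 0 -> forall j, j \in s -> c j = 0) /\
  (forall x : V, exists (s : seq J) (c : J -> K),
     x = \sum_(j <- s) c j *: v j).

Definition simultaneously_orthogonalizable (K : fieldType) (V : lmodType K)
    (I : Type) (F : I -> {symmetric V}) : Prop :=
  exists (J : eqType) (v : J -> V),
    is_basis v /\ forall i j k, j != k -> F i (v j) (v k) = 0.

Definition direct_sum (K : fieldType) (V : lmodType K)
    (S S' : submodClosed V) : Prop :=
  (forall x : V, exists s s', [/\ s \in S, s' \in S' & x = s + s']) /\
  (forall x, x \in S -> x \in S' -> x = 0).

Definition is_supplement (K : fieldType) (V : lmodType K) (I : Type)
    (F : I -> {symmetric V}) (S S' : submodClosed V) : Prop :=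
  direct_sum S S' /\
  (forall i s s', s \in S -> s' \in S' -> F i s s' = 0).

(* Main.v *)
(* As V <> 0 and rad(F) = 0, some F_i is not identically zero. For a basis    *)
(* v orthogonal for the family, F_i(x, v_j) is the j-th coordinate of x times *)
(* F_i(v_j, v_j), so rad(F_i) is the span of the v_j isotropic for F_i, and   *)
(* the span of the other v_j is the required supplement. Conversely,          *)
(* orthogonal bases of the two summands together form an orthogonal basis.    *)
Require Import Defs.
From HB Require Import structures.
From mathcomp Require Import all_boot all_order all_algebra.
From mathcomp Require Import boolp classical_sets.

Set Implicit Arguments.
Unset Strict Implicit.
Unset Printing Implicit Defensive.

Import GRing.Theory.

Local Open Scope ring_scope.

(** Pairing $x$ with a vector $v_j$ of a common orthogonal basis isolates the $j$-th coordinate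
    ([orthogonal_coord]). Hence for each $i$ the basis splits into the vectors isotropic for $F_i$,
    which span its radical ([radical_lspan]), and the others, which span an $F$-supplement
    ([radical_supplement]); each part is an orthogonal basis of its span ([orthogonalizable_lspan]).
    For the converse, orthogonal bases of two supplementary subspaces are glued together
    ([supplement_orthogonalizable]). *)

(* Combinations are lists of (coefficient, index) pairs, so that closure      *)
(* under addition is concatenation.                                           *)
Definition lspan (K : fieldType) (V : lmodType K) (J : eqType) (v : J -> V)
    (P : pred J) : {pred V} :=
  mem [set x | exists2 t : seq (K * J), {in t, forall p, P p.2}
                                      & x = \sum_(p <- t) p.1 *: v p.2]%classic.

Lemma lspanP (K : fieldType) (V : lmodType K) (J : eqType) (v : J -> V)
    (P : pred J) (x : V) :
  x \in lspan v P <-> exists2 t : seq (K * J), {in t, forall p, P p.2}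
                                   & x = \sum_(p <- t) p.1 *: v p.2.
Proof. by split=> [/asboolP | h]; last apply/asboolP. Qed.

Lemma lspan_submod_closed (K : fieldType) (V : lmodType K) (J : eqType)
    (v : J -> V) (P : pred J) : submod_closed (lspan v P).
Proof.
split=> [|a x y /lspanP[t Pt ->] /lspanP[u Pu ->]]; apply/lspanP.
  by exists [::]; rewrite ?big_nil.
exists ([seq (a * p.1, p.2) | p <- t] ++ u) => [p|].
  by rewrite mem_cat => /orP[/mapP[q /Pt Pq ->] | /Pu].
rewrite big_cat big_map scaler_sumr; congr (_ + _).
by apply: eq_bigr => p _; rewrite scalerA.
Qed.

HB.instance Definition _ (K : fieldType) (V : lmodType K) (J : eqType)
    (v : J -> V) (P : pred J) :=
  GRing.isSubmodClosed.Build K V (lspan v P) (lspan_submod_closed v P).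

(** Adding up the coefficients of equal indices makes the list duplicate-free, as linear
    independence and the reading of coordinates require. *)
Lemma lspan_uniq (K : fieldType) (V : lmodType K) (J : eqType) (v : J -> V)
    (P : pred J) (x : V) :
  x \in lspan v P -> exists s (c : J -> K),
    [/\ uniq s, {in s, forall j, P j} & x = \sum_(j <- s) c j *: v j].
Proof.
case/lspanP=> t Pt ->; exists (undup (map snd t)).
exists (fun j => \sum_(p <- t | p.2 == j) p.1); split.
- exact: undup_uniq.
- by move=> j; rewrite mem_undup => /mapP[p /Pt ? ->].
under [RHS]eq_bigr do rewrite scaler_suml.
rewrite (exchange_big_dep predT) //=; apply: eq_big_seq => p pt.
have p2t : p.2 \in undup (map snd t) by rewrite mem_undup map_f.
rewrite big_mkcond (bigD1_seq p.2) ?undup_uniq //= eqxx.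
by rewrite big1 ?addr0 // => j; rewrite eq_sym => /negPf->.
Qed.

Lemma lspan_sum (K : fieldType) (V : lmodType K) (J : eqType) (v : J -> V)
    (P : pred J) (s : seq J) (c : J -> K) :
  \sum_(j <- s | P j) c j *: v j \in lspan v P.
Proof.
apply/lspanP; exists [seq (c j, j) | j <- s & P j]; last first.
  by rewrite big_map big_filter.
by move=> p /mapP[j + ->]; rewrite mem_filter => /andP[].
Qed.

Lemma basis_uniq (K : fieldType) (V : lmodType K) (J : eqType) (v : J -> V)
    (x : V) :
  is_basis v -> exists s (c : J -> K), uniq s /\ x = \sum_(j <- s) c j *: v j.
Proof.
case=> _ /(_ x)[s [c ->]].
by have [s' [c' [? _ ->]]] := lspan_uniq (lspan_sum v predT s c); exists s', c'.
Qed.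

Lemma orthogonal_coord (K : fieldType) (V : lmodType K) (f : {symmetric V})
    (J : eqType) (v : J -> V) (s : seq J) (c : J -> K) (j : J) :
    (forall j k, j != k -> f (v j) (v k) = 0) -> uniq s -> j \in s ->
  f (\sum_(k <- s) c k *: v k) (v j) = c j * f (v j) (v j).
Proof.
move=> fv s_uniq js; rewrite linear_sumlz (bigD1_seq j) //= linearZl_LR.
by rewrite big1 ?addr0 // => k kj; rewrite linearZl_LR /= fv ?mulr0.
Qed.

Lemma basis_radical (K : fieldType) (V : lmodType K) (f : {symmetric V})
    (J : eqType) (v : J -> V) (x : V) :
  is_basis v -> (forall j, f x (v j) = 0) -> x \in radical f.
Proof.
move=> [_ v_gen] fx; apply/radicalP => y; have [s [c ->]] := v_gen y.
by rewrite linear_sumr big1 // => j _; rewrite linearZr_LR /= fx mulr0.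
Qed.

(** If $x$ is in the radical, pairing it with a non-isotropic $v_j$ forces its $j$-th coordinate to
    vanish. Conversely, an isotropic $v_j$ is orthogonal to the whole basis, hence to $V$. *)
Lemma radical_lspan (K : fieldType) (V : lmodType K) (f : {symmetric V})
    (J : eqType) (v : J -> V) :
    is_basis v -> (forall j k, j != k -> f (v j) (v k) = 0) ->
  radical f =i lspan v (fun j => f (v j) (v j) == 0).
Proof.
move=> v_basis fv x; apply/idP/idP => [/radicalP fx | /lspanP[t Pt ->]].
  have [s [c [s_uniq def_x]]] := basis_uniq x v_basis.
  suff -> : x = \sum_(j <- s | f (v j) (v j) == 0) c j *: v j by exact: lspan_sum.
  rewrite def_x (bigID (fun j => f (v j) (v j) == 0)) /= addrC.
  rewrite big_seq_cond big1 ?add0r // => j /andP[js fvj].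
  have /eqP := fx (v j); rewrite def_x orthogonal_coord // mulf_eq0.
  by rewrite (negPf fvj) orbF => /eqP->; rewrite scale0r.
apply: (basis_radical v_basis) => j; rewrite linear_sumlz big_seq big1 // => p pt.
rewrite linearZl_LR /=; have [<- | /fv->] := eqVneq p.2 j; last exact: mulr0.
by rewrite (eqP (Pt p pt)) mulr0.
Qed.

Lemma val_lincomb (K : fieldType) (V : lmodType K) (S : submodClosed V)
    (J : Type) (u : J -> subspace S) (s : seq J) (c : J -> K) :
  val (\sum_(j <- s) c j *: u j) = \sum_(j <- s) c j *: val (u j).
Proof. by rewrite raddf_sum; apply: eq_bigr => j _; exact: linearZ_LR. Qed.

(** The $v_j$ with [P j] form the required basis. [S] is only extensionally equal to the span, so
    that it can be the radical. *)
Lemma orthogonalizable_lspan (K : fieldType) (V : lmodType K) (I : Type)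
    (F : I -> {symmetric V}) (J : eqType) (v : J -> V) (P : pred J)
    (S : submodClosed V) :
    is_basis v -> (forall i j k, j != k -> F i (v j) (v k) = 0) ->
    S =i lspan v P ->
  simultaneously_orthogonalizable (restr_family F S).
Proof.
move=> [v_free _] Fv defS.
have vS (j : {j | P j}) : v (val j) \in S.
  rewrite defS; have := lspan_sum v P [:: val j] (fun=> 1).
  by rewrite big_mkcond big_seq1 (valP j) scale1r.
exists {j | P j}, (fun j => exist (fun x => x \in S) _ (vS j)); split; last first.
  by move=> i j k jk; apply: Fv.
split=> [s c s_uniq sum0 j js | x].
  (* [d] extends [c] by zero to all of [J], where the independence of [v] applies. *)
  pose d k := oapp c 0 (insub k : option {j | P j}).
  have dE k : d (val k) = c k by rewrite /d valK.
  rewrite -dE; apply: (v_free (map val s)); last exact: map_f.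
    by rewrite map_inj_uniq //; exact: val_inj.
  rewrite big_map; have /(congr1 val) := sum0.
  rewrite val_lincomb => sum0'; rewrite -[RHS]sum0'.
  by apply: eq_bigr => k _; rewrite dE.
have := valP x; rewrite /= defS => /lspan_uniq[s [c [_ Ps def_x]]].
have [t def_s] : exists t : seq {j | P j}, s = map val t.
  exists (pmap insub s); rewrite pmap_filter; last exact: insubK.
  by apply/esym/all_filterP/allP => j /Ps Pj; rewrite isSome_insub.
exists t, (c \o val); apply: val_inj.
by rewrite val_lincomb /= def_x def_s big_map.
Qed.

Lemma big_sum_type (V : nmodType) (J L : Type) (s : seq (J + L))
    (f : J + L -> V) :
  \sum_(j <- s) f j =
    \sum_(j <- pmap (fun x => if x is inl j then Some j else None) s) f (inl j)
  + \sum_(l <- pmap (fun x => if x is inr l then Some l else None) s) f (inr l).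
Proof.
elim: s => [|[j|l] s IHs] /=; rewrite ?big_nil ?addr0 // !big_cons IHs.
  by rewrite addrA.
by rewrite addrCA.
Qed.

(** A vanishing combination splits as $a + b = 0$ with $a \in S$ and $b \in T$. So $a = -b$ lies in
    $S \cap T = 0$, and each half vanishes separately. *)
Lemma direct_sum_basis (K : fieldType) (V : lmodType K) (S T : submodClosed V)
    (J L : eqType) (u : J -> subspace S) (w : L -> subspace T) :
    direct_sum S T -> is_basis u -> is_basis w ->
  is_basis (fun x : J + L => match x with inl j => val (u j)
                                        | inr l => val (w l) end).
Proof.
move=> [ST_gen ST_cap] [u_free u_gen] [w_free w_gen]; split.
  move=> s c s_uniq; rewrite big_sum_type.
  set sJ := pmap _ s; set sL := pmap _ s.
  have sJ_uniq : uniq sJ by apply: (@pmap_uniq _ _ _ inl) => // -[].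
  have sL_uniq : uniq sL by apply: (@pmap_uniq _ _ _ inr) => // -[].
  pose a := \sum_(j <- sJ) (c \o inl) j *: u j.
  pose b := \sum_(l <- sL) (c \o inr) l *: w l.
  rewrite -(val_lincomb u sJ (c \o inl)) -(val_lincomb w sL (c \o inr)) -/a -/b => ab0.
  have a0 : val a = 0.
    apply: ST_cap; first exact: valP.
    suff -> : val a = val (- b) by exact: valP.
    by apply/eqP; rewrite raddfN -addr_eq0 ab0.
  have b0 : val b = 0 by rewrite -ab0 a0 add0r.
  case=> [j | l] xs.
    apply: (u_free sJ (c \o inl)) => //; first exact: val_inj.
    by rewrite mem_pmap; apply/mapP; exists (inl j).
  apply: (w_free sL (c \o inr)) => //; first exact: val_inj.
  by rewrite mem_pmap; apply/mapP; exists (inr l).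
move=> x; have [y [z [yS zT ->]]] := ST_gen x.
have [s [c /(congr1 val)]] := u_gen (exist (fun x => x \in S) y yS).
have [t [d /(congr1 val)]] := w_gen (exist (fun x => x \in T) z zT).
rewrite !val_lincomb /= => -> ->.
exists (map inl s ++ map inr t).
exists (fun x => match x with inl j => c j | inr l => d l end).
by rewrite big_cat !big_map.
Qed.

Lemma supplement_orthogonalizable (K : fieldType) (V : lmodType K) (I : Type)
    (F : I -> {symmetric V}) (S T : submodClosed V) :
    is_supplement F S T -> simultaneously_orthogonalizable (restr_family F S) ->
    simultaneously_orthogonalizable (restr_family F T) ->
  simultaneously_orthogonalizable F.
Proof.
move=> [ST_sum ST_orth] [J [u [u_basis Fu]]] [L [w [w_basis Fw]]].
eexists; eexists; split; first exact: direct_sum_basis ST_sum u_basis w_basis.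
move=> i [j|l] [j'|l'] ne.
- exact: Fu.
- by apply: ST_orth; exact: valP.
- by rewrite hermC /= mul1r; apply: ST_orth; exact: valP.
- exact: Fw.
Qed.

Lemma radical_supplement (K : fieldType) (V : lmodType K) (I : Type)
    (F : I -> {symmetric V}) (J : eqType) (v : J -> V) (i : I) :
    is_basis v -> (forall i j k, j != k -> F i (v j) (v k) = 0) ->
  is_supplement F (radical (F i)) (lspan v (fun j => F i (v j) (v j) != 0)).
Proof.
move=> v_basis Fv; split; first split.
- move=> x; have [_ /(_ x)[s [c ->]]] := v_basis.
  rewrite (bigID (fun j => F i (v j) (v j) == 0)) /=.
  by do 2!eexists; split; last reflexivity;
    rewrite ?(radical_lspan v_basis (Fv i)); exact: lspan_sum.
(* All indices of $x$ are non-isotropic, so pairing with each $v_j$ kills its coefficient. *)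
- move=> x /radicalP xR /lspan_uniq[s [c [s_uniq Ps def_x]]].
  rewrite def_x big_seq big1 // => j js.
  have /eqP := xR (v j); rewrite def_x orthogonal_coord //; last exact: Fv.
  by rewrite mulf_eq0 (negPf (Ps j js)) orbF => /eqP->; rewrite scale0r.
move=> k x y; rewrite (radical_lspan v_basis (Fv i)).
move=> /lspanP[t Pt ->] /lspanP[u Pu ->].
rewrite linear_sumlz big_seq big1 // => p /Pt Pp.
rewrite linear_sumr big_seq big1 // => q /Pu Pq.
rewrite linearZl_LR linearZr_LR /= Fv ?mulr0 //.
(* The two indices differ: one is isotropic for [F i], the other is not. *)
by apply: contraTneq Pp => ->.
Qed.

(** A vector of $S$ orthogonal to $S$ is also orthogonal to the radical of $F_i$, hence to $V$; it
    lies in the radical and in $S$, so it is zero. *)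
Lemma supplement_radical_nondegenerate (K : fieldType) (V : lmodType K)
    (I : Type) (F : I -> {symmetric V}) (i : I) (S : submodClosed V) :
  is_supplement F (radical (F i)) S -> nondegenerate_form (restr_family F S i).
Proof.
move=> [[gen cap] _] x; rewrite inE; apply/idP/eqP => [/radicalP Fx | ->].
  apply/val_inj/cap; last exact: valP.
  apply/radicalP => y; have [r [s [/radicalP Fr sS ->]]] := gen y.
  rewrite linearDr /= hermC /= Fr mulr0 add0r.
  exact: (Fx (exist (fun x => x \in S) s sS)).
exact: rpred0.
Qed.

Theorem theorem3 (K : fieldType) (V : lmodType K) (I : Type)
    (F : I -> {symmetric V})
    (I_nonempty : inhabited I)
    (V_nontrivial : exists x : V, x != 0)
    (radF : family_radical F =i pred1 0) :
  simultaneously_orthogonalizable F <->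
  exists i : I,
    ~ (radical (F i) =i predT) /\
    exists S' : submodClosed V,
      [/\ is_supplement F (radical (F i)) S',
          simultaneously_orthogonalizable (restr_family F S') /\
          nondegenerate_family (restr_family F S')
        & simultaneously_orthogonalizable (restr_family F (radical (F i)))].
Proof.
split=> [[J [v [v_basis Fv]]] | [i [_ [S [sup [FS _] Frad]]]]]; last first.
  exact: supplement_orthogonalizable sup Frad FS.
(* If every $F_i$ had radical $V$, the radical of the family would be $V$, which is nonzero. *)
have [i iP] : exists i, ~ (radical (F i) =i predT).
  apply: contrapT => radT; have [x /negP[]] := V_nontrivial.
  suff : x \in family_radical F by rewrite radF.
  apply/asboolP => i _; apply: contrapT => xi; apply: radT; exists i => radi.
  by apply: xi; rewrite /= radi.
have sup := radical_supplement i v_basis Fv.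
exists i; split=> //; eexists; split; first exact: sup.
  split; first exact: (orthogonalizable_lspan v_basis Fv).
  by exists i; exact: supplement_radical_nondegenerate sup.
exact: (orthogonalizable_lspan v_basis Fv (radical_lspan v_basis (Fv i))).
Qed.
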